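(* Let $n\ge1$. For each $f\in\mathcal{C}$, the averages $$\mathcal{A}_r[f](z)=\frac{1}{2r}\int_{-r}^{r}f_t(z)\,dt,\qquad z\in\mathbb{H}^n,\ r>0,$$ converge locally uniformly on $\mathbb{H}^n$ to $\mathbf{g}(z)=\frac1n\sum_{j=1}^nz_j$ as $r\to\infty$.
   Context: $\mathbb{H}$ is the upper half-plane. $\mathcal{C}$ is the family of holomorphic maps $f:\mathbb{H}^n\to\mathbb{H}$ such that $f(\lambda,\ldots,\lambda)=\lambda$ and $\frac{\partial f}{\partial z_j}(\lambda,\ldots,\lambda)=\frac1n$ for all $\lambda\in\mathbb{H}$ and $j=1,\ldots,n$. For $t\in\mathbb{R}$, $f_t(z_1,\ldots,z_n)=f(z_1-t,\ldots,z_n-t)+t$. *)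

(* Defs.v *)
From HB Require Import structures.
From mathcomp Require Import all_boot all_order all_algebra.
From mathcomp Require Import all_classical all_reals all_analysis.
From mathcomp Require Import complex.

Set Implicit Arguments.
Unset Strict Implicit.
Unset Printing Implicit Defensive.

Import Order.TTheory GRing.Theory Num.Theory numFieldNormedType.Exports.

Local Open Scope classical_set_scope.
Local Open Scope ring_scope.
Local Open Scope complex_scope.

(* MathComp-Analysis puts the norm topology on R[i]^o only; it is transported
   here to R[i] itself, so that 'rV[R[i]]_n (with the sup norm) and R[i] are
   normed modules over R[i], and [differentiable], ['D_v f] on them are the
   complex derivatives. *)
#[export, non_forgetful_inheritance]
HB.instance Definition _ (R : rcfType) := NormedModule.copy R[i] R[i]^o.

Section Defs.
Context {R : realType}.

Definition upper_half_plane : set R[i] := [set z | 0 < complex.Im z].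

Definition upper_half_space (n : nat) : set 'rV[R[i]]_n :=
  [set z | forall j, upper_half_plane (z ord0 j)].

(* A map H^n -> H is represented by a total function on C^n, of which only the
   restriction to H^n is constrained; as H^n is open, complex differentiability
   and derivatives at points of H^n depend on that restriction only. *)
Definition holomorphic_on (n : nat) (D : set 'rV[R[i]]_n)
    (f : 'rV[R[i]]_n -> R[i]) : Prop :=
  forall z, D z -> differentiable f z.

Definition partial_derivative (n : nat) (j : 'I_n) (f : 'rV[R[i]]_n -> R[i]) :
  'rV[R[i]]_n -> R[i] := 'D_(delta_mx ord0 j) f.

Definition class_C (n : nat) : set ('rV[R[i]]_n -> R[i]) :=
  [set f | [/\ holomorphic_on (@upper_half_space n) f,
     (forall z, upper_half_space z -> upper_half_plane (f z)),
     (forall l, upper_half_plane l -> f (const_mx l) = l) &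
     (forall l j, upper_half_plane l ->
        partial_derivative j f (const_mx l) = n%:R^-1)]].

Definition translate (n : nat) (t : R) (f : 'rV[R[i]]_n -> R[i]) :
    'rV[R[i]]_n -> R[i] :=
  fun z => f (z - const_mx t%:C) + t%:C.

Definition complex_integral (a b : R) (h : R -> R[i]) : R[i] :=
  (\int[lebesgue_measure]_(t in `[a, b]) complex.Re (h t)) +i*
  (\int[lebesgue_measure]_(t in `[a, b]) complex.Im (h t)).

Definition average (n : nat) (f : 'rV[R[i]]_n -> R[i]) (r : R) :
    'rV[R[i]]_n -> R[i] :=
  fun z => ((2 * r)^-1)%:C * complex_integral (- r) r (fun t => translate t f z).

Definition mean (n : nat) : 'rV[R[i]]_n -> R[i] :=
  fun z => n%:R^-1 * \sum_(j < n) z ord0 j.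

End Defs.

Arguments upper_half_space {R} n _.
Arguments class_C {R} n _.
Arguments mean {R} n _.

Definition locally_uniform_cvg (T : topologicalType) (V : uniformType)
    (D : set T) (F : set_system (T -> V)) (g : T -> V) : Prop :=
  forall z, D z -> exists2 U, nbhs z U & {uniform U `&` D, F --> g}.

(* Main.v *)
Require Import Defs.
From mathcomp Require Import all_boot all_order all_algebra.
From mathcomp Require Import all_classical all_reals all_analysis.
From mathcomp Require Import complex.
From mathcomp Require Import ring lra.

Set Implicit Arguments.
Unset Strict Implicit.
Unset Printing Implicit Defensive.

Import Order.TTheory GRing.Theory Num.Theory numFieldNormedType.Exports.

Local Open Scope classical_set_scope.
Local Open Scope ring_scope.
Local Open Scope complex_scope.

(** With [w] complex, [k w = f (z - w) + w] is holomorphic for [w] in the closed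
    lower half-plane (and slightly above), and the average is the mean of [k] over
    [[-r, r]].  Cauchy's theorem on [[-r, r] x [-Y, 0]] moves the segment down to
    height [-Y].  There [k] is within [O(1 / Y)] of the mean of [z]: restricting [f]
    to the complex line through a point of the diagonal in the direction [z] gives a
    map from a square of side of order [Y] to the half-plane whose value and
    derivative at one point are known, and after a Cayley transform the Schwarz
    lemma of order two applies.  On the vertical sides [k] is bounded uniformly in
    [r], by chaining first-order Schwarz estimates from the diagonal, so these sides
    contribute [O(Y / r)].

    The Schwarz lemmas follow from a maximum principle with a non-sharp constant for
    functions on a punctured square, which comes from Goursat's theorem and a
    lower bound for the integral of [1 / s] over the boundary of the square. *)

(** * Real-valued modulus on [R[i]] *)

Section Modulus.
Context {R : realType}.
Implicit Types z w : R[i].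

(** The norm of [R[i]] takes its values in [R[i]]; this is the same number read in the ordered field
    [R], where estimates are carried out. *)
Definition modulus z : R := Normc.normc z.
Arguments modulus : simpl never.

Lemma normr_modulus z : `|z| = (modulus z)%:C.
Proof. by []. Qed.

Lemma modulus_ge0 z : 0 <= modulus z.
Proof. by case: z => x y; rewrite /modulus /= sqrtr_ge0. Qed.

Lemma modulusD z w : modulus (z + w) <= modulus z + modulus w.
Proof. exact: le_normcD. Qed.

Lemma modulusN z : modulus (- z) = modulus z.
Proof. exact: normcN. Qed.

Lemma modulusB z w : modulus (z - w) <= modulus z + modulus w.
Proof. by rewrite -(modulusN w) modulusD. Qed.

Lemma modulus_distC z w : modulus (z - w) = modulus (w - z).
Proof. by rewrite -modulusN opprB. Qed.

Lemma modulusM z w : modulus (z * w) = modulus z * modulus w.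
Proof. exact: Normc.normcM. Qed.

Lemma modulusV z : modulus z^-1 = (modulus z)^-1.
Proof. exact: Normc.normcV. Qed.

Lemma modulus_real (x : R) : modulus x%:C = `|x|.
Proof. by rewrite /modulus /= expr0n addr0 sqrtr_sqr. Qed.

Lemma modulus_realB (x y : R) : modulus (x%:C - y%:C) = `|x - y|.
Proof. by rewrite -modulus_real rmorphB. Qed.

Lemma modulus_i : modulus 'i = 1.
Proof. by rewrite /modulus /= expr0n add0r expr1n sqrtr1. Qed.

Lemma modulus_eq0 z : (modulus z == 0) = (z == 0).
Proof.
apply/eqP/eqP => [/Normc.eq0_normc //|->].
exact: Normc.normc0.
Qed.

Lemma modulus_gt0 z : (0 < modulus z) = (z != 0).
Proof. by rewrite lt0r modulus_ge0 andbT modulus_eq0. Qed.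

Lemma modulus0 : modulus 0 = 0.
Proof. by apply/eqP; rewrite modulus_eq0. Qed.

Lemma modulus_nat n : modulus n%:R = n%:R.
Proof.
have -> : (n%:R : R[i]) = (n%:R : R)%:C by rewrite rmorph_nat.
by rewrite modulus_real normr_nat.
Qed.

Lemma ge_modulus_Re z : `|complex.Re z| <= modulus z.
Proof.
case: z => x y; rewrite /modulus /= -sqrtr_sqr ler_wsqrtr //.
by rewrite lerDl sqr_ge0.
Qed.

Lemma ge_modulus_Im z : `|complex.Im z| <= modulus z.
Proof.
case: z => x y; rewrite /modulus /= -sqrtr_sqr ler_wsqrtr //.
by rewrite lerDr sqr_ge0.
Qed.

Lemma modulus_le_ReIm z : modulus z <= `|complex.Re z| + `|complex.Im z|.
Proof.
rewrite {1}[z]complexE; apply: le_trans (modulusD _ _) _.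
by rewrite modulusM modulus_i mul1r !modulus_real.
Qed.

Lemma sqr_modulus z : modulus z ^+ 2 = complex.Re z ^+ 2 + complex.Im z ^+ 2.
Proof.
by case: z => x y; rewrite /modulus /= sqr_sqrtr // addr_ge0 // sqr_ge0.
Qed.

Lemma ReD z w : complex.Re (z + w) = complex.Re z + complex.Re w.
Proof. by case: z w => ? ? [? ?]. Qed.

Lemma ImD z w : complex.Im (z + w) = complex.Im z + complex.Im w.
Proof. by case: z w => ? ? [? ?]. Qed.

Lemma ReN z : complex.Re (- z) = - complex.Re z.
Proof. by case: z. Qed.

Lemma ImN z : complex.Im (- z) = - complex.Im z.
Proof. by case: z. Qed.

Lemma ReM z w : complex.Re (z * w) =
  complex.Re z * complex.Re w - complex.Im z * complex.Im w.
Proof. by case: z w => ? ? [? ?]. Qed.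

Lemma ImM z w : complex.Im (z * w) =
  complex.Re z * complex.Im w + complex.Im z * complex.Re w.
Proof. by case: z w => ? ? [? ?]. Qed.

Lemma eq_ReIm z w : complex.Re z = complex.Re w -> complex.Im z = complex.Im w ->
  z = w.
Proof. by case: z w => ? ? [? ?] /= -> ->. Qed.

Lemma ltC_real (e : R[i]) : 0 < e -> exists2 r : R, 0 < r & e = r%:C.
Proof.
case: e => x y; rewrite ltcE /= => /andP[/eqP -> x0].
by exists x.
Qed.

(** The differential is complex linear, hence multiplication by its value at 1, so differentiability
    is the usual first-order expansion with error [e * modulus (s - p)]. *)
Lemma differentiable_eps (F : R[i] -> R[i]) p : differentiable F p ->
  forall e : R, 0 < e -> exists2 dl : R, 0 < dl &
    forall s, modulus (s - p) < dl ->
      modulus (F s - F p - 'd F p 1 * (s - p)) <= e * modulus (s - p).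
Proof.
move=> dF e e0.
have /eqaddoP/(_ e%:C) := diff_locally dF.
rewrite ltcR => /(_ e0) /nbhs_ballP[d /= /ltC_real[r r0 ->] H].
exists r => // s sp.
have /H : ball (0 : R[i]) r%:C (s - p).
  by rewrite -ball_normE /= sub0r normrN normr_modulus ltcR.
rewrite !normr_modulus -[_%:C * _]rmorphM lecR /= !fctE /= subrK.
have -> : 'd F p (s - p) = (s - p) * 'd F p 1.
  by rewrite -{1}[s - p]mulr1 -[(s - p) * 1]/((s - p) *: (1 : R[i])) linearZ.
by rewrite mulrC opprD addrA.
Qed.

End Modulus.

Arguments modulus : simpl never.

(** * Integrals of complex-valued functions over a real segment *)

Section ComplexIntegral.
Context {R : realType}.
Implicit Types (u v : R -> R[i]) (a b m M : R).
Let mu := @lebesgue_measure R.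

Definition complex_integrable a b u :=
  mu.-integrable `[a, b] (EFin \o (fun t => complex.Re (u t))) /\
  mu.-integrable `[a, b] (EFin \o (fun t => complex.Im (u t))).

Definition continuous_curve u t := forall e : R, 0 < e ->
  exists2 dl : R, 0 < dl &
    forall t', `|t' - t| < dl -> modulus (u t' - u t) <= e.

Lemma integrable_continuous_at a b (h : R -> R) :
  (forall t, a <= t <= b -> forall e : R, 0 < e -> exists2 dl : R, 0 < dl &
    forall t', `|t' - t| < dl -> `|h t' - h t| <= e) ->
  mu.-integrable `[a, b] (EFin \o h).
Proof.
move=> hc; apply: continuous_compact_integrable; first exact: segment_compact.
apply: continuous_in_subspaceT => t; rewrite inE /= in_itv /= => tab.
apply/cvgrPdist_le => e e0; have [d d0 H] := hc t tab e e0.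
by exists d => //= t' /= tt'; rewrite distrC H // distrC.
Qed.

Lemma continuous_curve_integrable a b u :
  (forall t, a <= t <= b -> continuous_curve u t) -> complex_integrable a b u.
Proof.
move=> uc; split; apply: integrable_continuous_at => t tab e e0;
  have [d d0 H] := uc t tab e e0; exists d => // t' /H; apply: le_trans.
  by rewrite -ReN -ReD ge_modulus_Re.
by rewrite -ImN -ImD ge_modulus_Im.
Qed.

Lemma complex_integrable_cst a b z : complex_integrable a b (fun=> z).
Proof.
apply: continuous_curve_integrable => t _ e e0; exists 1 => // t' _.
by rewrite subrr modulus0 ltW.
Qed.

Lemma integrableZr a b (c : R) (h : R -> R) :
  mu.-integrable `[a, b] (EFin \o h) ->
  mu.-integrable `[a, b] (EFin \o (fun t => c * h t)).
Proof.
move=> ih; have := integrableZl (mu := mu) (measurable_itv _) c ih.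
by apply: eq_integrable => // t _; rewrite /= EFinM.
Qed.

Lemma complex_integrableB a b u v : complex_integrable a b u ->
  complex_integrable a b v -> complex_integrable a b (fun t => u t - v t).
Proof.
move=> [ru iu] [rv iv]; split.
  have := integrableB (mu := mu) (measurable_itv _) ru rv.
  by apply: eq_integrable => // t _ /=; rewrite ReD ReN EFinB.
have := integrableB (mu := mu) (measurable_itv _) iu iv.
by apply: eq_integrable => // t _ /=; rewrite ImD ImN EFinB.
Qed.

Lemma complex_integrableZ a b z u : complex_integrable a b u ->
  complex_integrable a b (fun t => z * u t).
Proof.
move=> [ru iu]; split.
  have := integrableB (mu := mu) (measurable_itv _)
    (integrableZr (complex.Re z) ru) (integrableZr (complex.Im z) iu).
  by apply: eq_integrable => // t _ /=; rewrite ReM EFinB.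
have := integrableD (mu := mu) (measurable_itv _)
  (integrableZr (complex.Re z) iu) (integrableZr (complex.Im z) ru).
by apply: eq_integrable => // t _ /=; rewrite ImM EFinD.
Qed.

Lemma eq_complex_integral a b u v : (forall t, a <= t <= b -> u t = v t) ->
  complex_integral a b u = complex_integral a b v.
Proof.
move=> uv; rewrite /complex_integral; congr (_ +i* _);
  by apply: eq_Rintegral => t; rewrite inE /= in_itv /= => /uv ->.
Qed.

Lemma complex_integralB a b u v : complex_integrable a b u ->
  complex_integrable a b v ->
  complex_integral a b (fun t => u t - v t) =
  complex_integral a b u - complex_integral a b v.
Proof.
move=> [ru iu] [rv iv]; apply: eq_ReIm.
  rewrite ReD ReN /= -(RintegralB (mu := mu) (measurable_itv _) ru rv).
  by apply: eq_Rintegral => t _; rewrite ReD ReN.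
rewrite ImD ImN /= -(RintegralB (mu := mu) (measurable_itv _) iu iv).
by apply: eq_Rintegral => t _; rewrite ImD ImN.
Qed.

Lemma complex_integralZ a b z u : complex_integrable a b u ->
  complex_integral a b (fun t => z * u t) = z * complex_integral a b u.
Proof.
move=> [ru iu].
have mab : measurable (`[a, b] : set (measurableTypeR R)) by exact: measurable_itv.
apply: eq_ReIm.
  rewrite ReM /= -(RintegralZl _ mab ru) -(RintegralZl _ mab iu).
  rewrite -(RintegralB mab (integrableZr _ ru) (integrableZr _ iu)).
  by apply: eq_Rintegral => t _; rewrite ReM.
rewrite ImM /= -(RintegralZl _ mab ru) -(RintegralZl _ mab iu).
rewrite -(RintegralD mab (integrableZr _ iu) (integrableZr _ ru)).
by apply: eq_Rintegral => t _; rewrite ImM.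
Qed.

Lemma complex_integralD a b u v : complex_integrable a b u ->
  complex_integrable a b v ->
  complex_integral a b (fun t => u t + v t) =
  complex_integral a b u + complex_integral a b v.
Proof.
move=> iu iv.
rewrite (@eq_complex_integral _ _ _ (fun t => u t - -1 * v t)); last first.
  by move=> t _; rewrite mulN1r opprK.
rewrite complex_integralB //; last exact: complex_integrableZ.
by rewrite complex_integralZ // mulN1r opprK.
Qed.

Lemma Rintegral_split a m b (h : R -> R) : a <= m -> m <= b ->
  mu.-integrable `[a, b] (EFin \o h) ->
  \int[mu]_(t in `[a, b]) h t =
  \int[mu]_(t in `[a, m]) h t + \int[mu]_(t in `[m, b]) h t.
Proof.
move=> am mb ih; have := Rintegral_itvB ih.
move=> /(_ m); rewrite !bnd_simp => /(_ am mb) /eqP.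
rewrite subr_eq addrC => /eqP ->; congr (_ + _).
(* The second piece comes out open at [m]; adding a single point does not change the integral. *)
apply: Rintegral_itv_obnd_cbnd; apply: integrableS ih => //.
by apply: subset_itvr; rewrite bnd_simp.
Qed.

Lemma complex_integral_split a m b u : a <= m -> m <= b ->
  complex_integrable a b u ->
  complex_integral a b u = complex_integral a m u + complex_integral m b u.
Proof.
move=> am mb [ru iu]; apply: eq_ReIm.
  by rewrite ReD /= (Rintegral_split am mb ru).
by rewrite ImD /= (Rintegral_split am mb iu).
Qed.

Lemma Rintegral_itv_cst a b (c : R) : a <= b ->
  \int[mu]_(t in `[a, b]) c = c * (b - a).
Proof.
move=> ab; rewrite Rintegral_cst //; congr (_ * _).
have /= -> := lebesgue_measure_itv `[a, b].
by rewrite lte_fin; case: ltgtP ab => // -> _; rewrite subrr.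
Qed.

Lemma complex_integral_cst a b z : a <= b ->
  complex_integral a b (fun=> z) = z * (b - a)%:C.
Proof.
move=> ab; apply: eq_ReIm.
  by rewrite ReM /= !mulr0 subr0 Rintegral_itv_cst.
by rewrite ImM /= !mulr0 add0r Rintegral_itv_cst.
Qed.

Lemma normr_Rintegral_le a b M (h : R -> R) : a <= b ->
  mu.-integrable `[a, b] (EFin \o h) ->
  (forall t, a <= t <= b -> `|h t| <= M) ->
  `|\int[mu]_(t in `[a, b]) h t| <= M * (b - a).
Proof.
move=> ab ih hM.
have mab : measurable (`[a, b] : set (measurableTypeR R)) by exact: measurable_itv.
apply: le_trans (le_normr_Rintegral mab ih) _.
rewrite -Rintegral_itv_cst //; apply: le_Rintegral => //.
- by have := integrable_norm ih; apply: eq_integrable.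
- by have [] := complex_integrable_cst a b M%:C.
Qed.

(** The real and imaginary parts are bounded separately by [M * (b - a)], whence the factor 2. *)
Lemma complex_integral_le a b M u : a <= b -> complex_integrable a b u ->
  (forall t, a <= t <= b -> modulus (u t) <= M) ->
  modulus (complex_integral a b u) <= 2 * M * (b - a).
Proof.
move=> ab [ru iu] uM; apply: le_trans (modulus_le_ReIm _) _ => /=.
rewrite -mulrA [2 * _]mulr_natl mulr2n lerD // normr_Rintegral_le // => t /uM.
  exact/le_trans/ge_modulus_Re.
exact/le_trans/ge_modulus_Im.
Qed.

End ComplexIntegral.

(** * Bisection of rectangles *)

Section NestedRectangles.
Context {R : realType}.

Lemma nested_intervals (a b : nat -> R) :
  (forall n, a n <= a n.+1) -> (forall n, b n.+1 <= b n) ->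
  (forall n, a n <= b n) -> exists x, forall n, a n <= x <= b n.
Proof.
move=> ai bd ab.
have am k n : a n <= a (n + k)%N.
  by elim: k => [|k IH]; rewrite ?addn0 // addnS (le_trans IH).
have bm k n : b (n + k)%N <= b n.
  by elim: k => [|k IH]; rewrite ?addn0 // addnS (le_trans (bd _)).
have abm n k : a n <= b k.
  by apply: le_trans (am k n) (le_trans (ab _) _); rewrite addnC bm.
exists (sup (range a)) => n; apply/andP; split.
  apply: ub_le_sup; last by exists n.
  by exists (b 0%N) => _ [k _ <-].
apply: ge_sup; first by exists (a 0%N), 0%N.
by move=> _ [k _ <-].
Qed.

Lemma exists_halving_lt (w dl : R) : 0 < dl -> exists n, w / 2 ^+ n < dl.
Proof.
move=> dl0; exists (Num.bound (w / dl)).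
rewrite ltr_pdivrMr ?exprn_gt0 // mulrC -ltr_pdivrMr //.
have [w0|w0] := leP 0 (w / dl).
  apply: lt_le_trans (archi_boundP w0) _.
  by rewrite -natrX ler_nat ltnW // ltn_expl.
by rewrite (lt_le_trans w0) // exprn_ge0.
Qed.

Variable P : R -> R -> R -> R -> Prop.

(** If [P] fails on a rectangle, it fails on one of its quarters. Iterating gives nested failing
    rectangles that shrink to a point, and near that point the local hypothesis yields [P]. *)
Lemma rectangle_induction a0 b0 c0 d0 : a0 <= b0 -> c0 <= d0 ->
  (forall a b c d, a <= b -> c <= d ->
    P a ((a + b) / 2) c ((c + d) / 2) -> P ((a + b) / 2) b c ((c + d) / 2) ->
    P a ((a + b) / 2) ((c + d) / 2) d -> P ((a + b) / 2) b ((c + d) / 2) d ->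
    P a b c d) ->
  (forall x y, a0 <= x <= b0 -> c0 <= y <= d0 -> exists2 dl, 0 < dl &
    forall a b c d, a <= x <= b -> c <= y <= d -> b - a < dl -> d - c < dl ->
    P a b c d) ->
  P a0 b0 c0 d0.
Proof.
move=> ab0 cd0 split4 local; apply: contrapT => nP0.
pose bad (q : R * R * R * R) := let: (a, b, c, d) := q in
  [/\ a <= b, c <= d & ~ P a b c d].
pose half (q q' : R * R * R * R) :=
  let: (a, b, c, d) := q in let: (a', b', c', d') := q' in
  [/\ a <= a', b' <= b, c <= c' & d' <= d] /\
  (b' - a' = (b - a) / 2 /\ d' - c' = (d - c) / 2).
(* The assumption [bad q] stands under the existential, so that choice yields a total map that can
   be iterated. *)
have next q : exists q', bad q -> bad q' /\ half q q'.
  case: q => [[[a b] c] d].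
  have [[ab cd nP]|nb] := pselect (bad (a, b, c, d)); last by exists (a, b, c, d).
  have amb : a <= (a + b) / 2 <= b by apply/andP; split; lra.
  have cmd : c <= (c + d) / 2 <= d by apply/andP; split; lra.
  have /andP[am mb] := amb; have /andP[cm md] := cmd.
  have [p1|n1] := pselect (P a ((a + b) / 2) c ((c + d) / 2)); last first.
    exists (a, (a + b) / 2, c, (c + d) / 2) => _; do !split => //; lra.
  have [p2|n2] := pselect (P ((a + b) / 2) b c ((c + d) / 2)); last first.
    exists ((a + b) / 2, b, c, (c + d) / 2) => _; do !split => //; lra.
  have [p3|n3] := pselect (P a ((a + b) / 2) ((c + d) / 2) d); last first.
    exists (a, (a + b) / 2, (c + d) / 2, d) => _; do !split => //; lra.
  have [p4|n4] := pselect (P ((a + b) / 2) b ((c + d) / 2) d); last first.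
    exists ((a + b) / 2, b, (c + d) / 2, d) => _; do !split => //; lra.
  by case: nP; exact: split4.
have [nx nxP] := choice next.
pose q n := iter n nx (a0, b0, c0, d0).
have badq n : bad (q n).
  by elim: n => [|n IH] //; have [] := nxP _ IH.
have halfq n : half (q n) (q n.+1) by have [] := nxP _ (badq n).
pose a n := (q n).1.1.1; pose b n := (q n).1.1.2.
pose c n := (q n).1.2; pose d n := (q n).2.
have qE n : q n = (a n, b n, c n, d n).
  by rewrite /a /b /c /d; case: (q n) => [[[]]].
have hq n := halfq n; have bq n := badq n.
have {}hq n : [/\ a n <= a n.+1, b n.+1 <= b n, c n <= c n.+1 & d n.+1 <= d n] /\
    (b n.+1 - a n.+1 = (b n - a n) / 2 /\ d n.+1 - c n.+1 = (d n - c n) / 2).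
  by have := hq n; rewrite !qE.
have {}bq n : [/\ a n <= b n, c n <= d n & ~ P (a n) (b n) (c n) (d n)].
  by have := bq n; rewrite !qE.
have [x xP] : exists x, forall n, a n <= x <= b n.
  by apply: nested_intervals => n; have [[]] := hq n; have [] := bq n.
have [y yP] : exists y, forall n, c n <= y <= d n.
  by apply: nested_intervals => n; have [[]] := hq n; have [] := bq n.
have wE n : b n - a n = (b0 - a0) / 2 ^+ n.
  elim: n => [|n IH]; first by rewrite expr0 divr1.
  by have [_ [-> _]] := hq n; rewrite IH exprSr invfM mulrA.
have hE n : d n - c n = (d0 - c0) / 2 ^+ n.
  elim: n => [|n IH]; first by rewrite expr0 divr1.
  by have [_ [_ ->]] := hq n; rewrite IH exprSr invfM mulrA.
have [dl dl0 small] := local x y (xP 0%N) (yP 0%N).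
have [n nE] := exists_halving_lt ((b0 - a0) + (d0 - c0)) dl0.
have [_ _] := bq n; apply; apply: small => //; rewrite ?wE ?hE;
  apply: le_lt_trans nE; rewrite ler_wpM2r ?invr_ge0 ?exprn_ge0 //; lra.
Qed.

End NestedRectangles.

(** * Contour integrals over the boundary of a rectangle *)

Section RectangleIntegral.
Context {R : realType}.
Implicit Types (F G : R[i] -> R[i]) (a b c d m M x y : R) (s p : R[i]).

Definition rectangle a b c d : set R[i] :=
  [set s | a <= complex.Re s <= b /\ c <= complex.Im s <= d].

Definition rectangle_boundary a b c d : set R[i] :=
  [set s | rectangle a b c d s /\
    [\/ complex.Re s = a, complex.Re s = b, complex.Im s = c | complex.Im s = d]].

(** The counterclockwise contour integral of [F s ds]: [ds] is [dx] on the horizontal sides and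
    ['i dy] on the vertical ones. *)
Definition rectangle_integral F a b c d : R[i] :=
  (complex_integral a b (fun x => F (x +i* c)) -
   complex_integral a b (fun x => F (x +i* d))) +
  'i * (complex_integral c d (fun y => F (b +i* y)) -
        complex_integral c d (fun y => F (a +i* y))).

Lemma differentiable_lipschitz_at F p : differentiable F p ->
  exists2 K, 0 < K & exists2 dl, 0 < dl &
    forall s, modulus (s - p) < dl -> modulus (F s - F p) <= K * modulus (s - p).
Proof.
move=> dF; have [dl dl0 H] := differentiable_eps dF ltr01.
exists (1 + modulus ('d F p 1)); first by rewrite ltr_pwDl // modulus_ge0.
exists dl => // s /H; rewrite mulrDl -modulusM => h.
rewrite -[F s - F p](subrK ('d F p 1 * (s - p))).
exact: le_trans (modulusD _ _) (lerD h (lexx _)).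
Qed.

Lemma continuous_curve_comp F (u : R -> R[i]) t :
  (forall t', modulus (u t' - u t) <= `|t' - t|) -> differentiable F (u t) ->
  continuous_curve (F \o u) t.
Proof.
move=> u1 /differentiable_lipschitz_at[K K0 [dl dl0 H]] e e0.
exists (Num.min dl (e / K)) => [|t']; first by rewrite lt_min dl0 divr_gt0.
rewrite lt_min => /andP[t1 t2] /=; apply: le_trans (H _ (le_lt_trans (u1 t') t1)) _.
apply: le_trans (ler_wpM2l (ltW K0) (u1 t')) _.
by rewrite mulrC -ler_pdivlMr // ltW.
Qed.

Lemma horizontal_integrable F a b y :
  (forall x, a <= x <= b -> differentiable F (x +i* y)) ->
  complex_integrable a b (fun x => F (x +i* y)).
Proof.
move=> dF; apply: continuous_curve_integrable => x /dF.
apply: (continuous_curve_comp (u := fun t => t +i* y)) => t'.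
by apply: le_trans (modulus_le_ReIm _) _; rewrite /= subrr normr0 addr0.
Qed.

Lemma vertical_integrable F c d x :
  (forall y, c <= y <= d -> differentiable F (x +i* y)) ->
  complex_integrable c d (fun y => F (x +i* y)).
Proof.
move=> dF; apply: continuous_curve_integrable => y /dF.
apply: (continuous_curve_comp (u := fun t => x +i* t)) => t'.
by apply: le_trans (modulus_le_ReIm _) _; rewrite /= subrr normr0 add0r.
Qed.

(** Lebesgue integration is linear on integrable functions only, so the linearity and splitting
    rules below carry this condition. *)
Definition boundary_integrable F a b c d :=
  [/\ complex_integrable a b (fun x => F (x +i* c)),
      complex_integrable a b (fun x => F (x +i* d)),
      complex_integrable c d (fun y => F (a +i* y)) &
      complex_integrable c d (fun y => F (b +i* y))].

Lemma differentiable_boundary_integrable F a b c d : a <= b -> c <= d ->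
  (forall s, rectangle_boundary a b c d s -> differentiable F s) ->
  boundary_integrable F a b c d.
Proof.
move=> ab cd dF; split; first [apply: horizontal_integrable => x xab
  | apply: vertical_integrable => x xab]; apply: dF; split;
  rewrite /rectangle /= ?lexx ?xab ?ab ?cd //.
- exact: Or43.
- exact: Or44.
- exact: Or41.
- exact: Or42.
Qed.

Lemma rectangle_integralB F G a b c d :
  boundary_integrable F a b c d -> boundary_integrable G a b c d ->
  rectangle_integral (fun s => F s - G s) a b c d =
  rectangle_integral F a b c d - rectangle_integral G a b c d.
Proof.
move=> [F1 F2 F3 F4] [G1 G2 G3 G4]; rewrite /rectangle_integral.
rewrite !complex_integralB //; ring.
Qed.

Lemma rectangle_integralZ F a b c d z : boundary_integrable F a b c d ->
  rectangle_integral (fun s => z * F s) a b c d = z * rectangle_integral F a b c d.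
Proof.
move=> [F1 F2 F3 F4]; rewrite /rectangle_integral !complex_integralZ //; ring.
Qed.

(** The perimeter is twice [(b - a) + (d - c)], and [complex_integral_le] contributes another factor
    2. *)
Lemma rectangle_integral_le F a b c d M : a <= b -> c <= d ->
  boundary_integrable F a b c d ->
  (forall s, rectangle_boundary a b c d s -> modulus (F s) <= M) ->
  modulus (rectangle_integral F a b c d) <= 4 * M * ((b - a) + (d - c)).
Proof.
move=> ab cd [F1 F2 F3 F4] FM.
have -> : 4 * M * ((b - a) + (d - c)) = (2 * M * (b - a) + 2 * M * (b - a)) +
  (2 * M * (d - c) + 2 * M * (d - c)) by ring.
apply: le_trans (modulusD _ _) _; apply: lerD.
  apply: le_trans (modulusB _ _) _; apply: lerD; apply: complex_integral_le => //;
    move=> t tab; apply: FM; split; rewrite /rectangle /= ?lexx ?tab ?ab ?cd //.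
  - exact: Or43.
  - exact: Or44.
rewrite modulusM modulus_i mul1r.
apply: le_trans (modulusB _ _) _; apply: lerD; apply: complex_integral_le => //;
  move=> t tab; apply: FM; split; rewrite /rectangle /= ?lexx ?tab ?ab ?cd //.
- exact: Or42.
- exact: Or41.
Qed.

(** On opposite sides the function differs by a constant, [u * 'i * (c - d)] between bottom and top
    and [u * (b - a)] between right and left; the two resulting products cancel. *)
Lemma rectangle_integral_affine a b c d (u v : R[i]) : a <= b -> c <= d ->
  rectangle_integral (fun s => u * s + v) a b c d = 0.
Proof.
move=> ab cd; have aff (x : R[i]) : differentiable (fun s : R[i] => u * s + v) x.
  by apply: differentiableD => //; apply: differentiableM.
have hI y := horizontal_integrable (a := a) (b := b) (fun x _ => aff (x +i* y)).
have vI x := vertical_integrable (c := c) (d := d) (fun y _ => aff (x +i* y)).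
rewrite /rectangle_integral -!complex_integralB //.
rewrite (@eq_complex_integral _ a b _ (fun=> u * 'i * (c - d)%:C)); last first.
  by move=> t _; apply: eq_ReIm; rewrite /= ?(ReD, ImD, ReM, ImM, ReN, ImN) /=; ring.
rewrite (@eq_complex_integral _ c d _ (fun=> u * (b - a)%:C)); last first.
  by move=> t _; apply: eq_ReIm; rewrite /= ?(ReD, ImD, ReM, ImM, ReN, ImN) /=; ring.
rewrite !complex_integral_cst // !rmorphB /=; ring.
Qed.

Lemma rectangle_integral_splitV F a m b c d : a <= m -> m <= b ->
  boundary_integrable F a b c d ->
  rectangle_integral F a b c d =
  rectangle_integral F a m c d + rectangle_integral F m b c d.
Proof.
move=> am mb [F1 F2 _ _]; rewrite /rectangle_integral.
rewrite (complex_integral_split am mb F1) (complex_integral_split am mb F2); ring.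
Qed.

Lemma rectangle_integral_splitH F a b c m d : c <= m -> m <= d ->
  boundary_integrable F a b c d ->
  rectangle_integral F a b c d =
  rectangle_integral F a b c m + rectangle_integral F a b m d.
Proof.
move=> cm md [_ _ F3 F4]; rewrite /rectangle_integral.
rewrite (complex_integral_split cm md F3) (complex_integral_split cm md F4); ring.
Qed.

End RectangleIntegral.

(** * Goursat's theorem, also with a puncture *)

Section Goursat.
Context {R : realType}.
Implicit Types (F H : R[i] -> R[i]) (a b c d M : R) (s p : R[i]).

Lemma sub_rectangle a b c d a' b' c' d' : a <= a' -> b' <= b -> c <= c' -> d' <= d ->
  rectangle a' b' c' d' `<=` rectangle a b c d.
Proof.
move=> h1 h2 h3 h4 s [/andP[h5 h6] /andP[h7 h8]]; split; apply/andP; split; lra.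
Qed.

Lemma modulus_rectangle a b c d s p : rectangle a b c d s -> rectangle a b c d p ->
  modulus (s - p) <= (b - a) + (d - c).
Proof.
move=> [/andP[h1 h2] /andP[h3 h4]] [/andP[h5 h6] /andP[h7 h8]].
apply: le_trans (modulus_le_ReIm _) _; rewrite ReD ImD ReN ImN.
by apply: lerD; rewrite ler_norml; apply/andP; split; lra.
Qed.

Lemma differentiable_affine (u v s : R[i]) : differentiable (fun s => u * s + v) s.
Proof. by apply: differentiableD => //; apply: differentiableM. Qed.

(** Subtracting the first-order expansion at [p] does not change the integral, and leaves an
    integrand of size [e] times the half-perimeter; the length of the contour gives the second
    factor. *)
Lemma rectangle_integral_small F p e dl : 0 < e ->
  (forall s, modulus (s - p) < dl ->
    modulus (F s - F p - 'd F p 1 * (s - p)) <= e * modulus (s - p)) ->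
  forall a b c d, a <= b -> c <= d -> rectangle a b c d p ->
    (b - a) + (d - c) < dl -> boundary_integrable F a b c d ->
  modulus (rectangle_integral F a b c d) <= 4 * e * ((b - a) + (d - c)) ^+ 2.
Proof.
move=> e0 H a b c d ab cd pR small iF.
pose L s := 'd F p 1 * s + (F p - 'd F p 1 * p).
have iL : boundary_integrable L a b c d.
  by apply: (differentiable_boundary_integrable ab cd) => s _; exact: differentiable_affine.
have -> : rectangle_integral F a b c d = rectangle_integral (fun s => F s - L s) a b c d.
  by rewrite rectangle_integralB // rectangle_integral_affine // subr0.
rewrite expr2 mulrA -(mulrA 4 e); apply: rectangle_integral_le => //.
  by case: iF iL => ? ? ? ? [? ? ? ?]; split; apply: complex_integrableB.
move=> s [sR _]; have sp := modulus_rectangle sR pR.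
have -> : F s - L s = F s - F p - 'd F p 1 * (s - p) by rewrite /L; ring.
by apply: le_trans (H _ (le_lt_trans sp small)) _; rewrite ler_wpM2l // ltW.
Qed.

Lemma eq0_modulus_le (z : R[i]) C : (forall e, 0 < e -> modulus z <= C * e) -> z = 0.
Proof.
move=> H; apply/eqP; rewrite -modulus_eq0 eq_le modulus_ge0 andbT.
apply/ler_addgt0Pl => e e0; rewrite addr0; have k0 : 0 < `|C| + 1 by rewrite ltr_wpDl.
apply: le_trans (H (e / (`|C| + 1)) _) _; first by rewrite divr_gt0.
rewrite mulrA ler_pdivrMr // mulrC (ler_wpM2l (ltW e0)) //.
by rewrite (le_trans (ler_norm _)) // lerDl.
Qed.

(** A bound by [e] times the squared half-perimeter holds for small rectangles and passes from the
    four quarters to the whole. Bisection gives it for the full rectangle, and [e] is arbitrary. *)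
Theorem goursat F a b c d : a <= b -> c <= d ->
  (forall s, rectangle a b c d s -> differentiable F s) ->
  rectangle_integral F a b c d = 0.
Proof.
move=> ab cd dF.
apply: (@eq0_modulus_le _ (4 * ((b - a) + (d - c)) ^+ 2)) => e e0.
rewrite -mulrA [_ * e]mulrC mulrA.
(* The four inequalities restrict the claim to subrectangles, where [F] is known to be
   differentiable. *)
pose P a' b' c' d' := a <= a' -> b' <= b -> c <= c' -> d' <= d ->
  modulus (rectangle_integral F a' b' c' d') <= 4 * e * ((b' - a') + (d' - c')) ^+ 2.
have iF a' b' c' d' : a <= a' -> b' <= b -> c <= c' -> d' <= d -> a' <= b' -> c' <= d' ->
    boundary_integrable F a' b' c' d'.
  move=> h1 h2 h3 h4 h5 h6; apply: differentiable_boundary_integrable => //.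
  by move=> s [sR _]; apply: dF; exact: sub_rectangle sR.
suff : P a b c d by apply.
apply: rectangle_induction => //.
  move=> a' b' c' d' ab' cd' P1 P2 P3 P4 h1 h2 h3 h4.
  set m := (a' + b') / 2 in P1 P2 P3 P4; set n := (c' + d') / 2 in P1 P2 P3 P4.
  have am : a' <= m by rewrite /m; lra.
  have mb : m <= b' by rewrite /m; lra.
  have cn : c' <= n by rewrite /n; lra.
  have nd : n <= d' by rewrite /n; lra.
  have {}P1 : _ <= _ := P1 h1 (le_trans mb h2) h3 (le_trans nd h4).
  have {}P2 : _ <= _ := P2 (le_trans h1 am) h2 h3 (le_trans nd h4).
  have {}P3 : _ <= _ := P3 h1 (le_trans mb h2) (le_trans h3 cn) h4.
  have {}P4 : _ <= _ := P4 (le_trans h1 am) h2 (le_trans h3 cn) h4.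
  rewrite (rectangle_integral_splitV am mb); last exact: iF.
  rewrite (rectangle_integral_splitH cn nd); last by apply: iF => //; lra.
  rewrite [X in _ + X](rectangle_integral_splitH cn nd); last by apply: iF => //; lra.
  apply: le_trans (modulusD _ _) _.
  apply: le_trans (lerD (modulusD _ _) (modulusD _ _)) _.
  apply: le_trans (lerD (lerD P1 P3) (lerD P2 P4)) _.
  (* Each quarter has half the half-perimeter, and four times a quarter of the square is the square,
     so the bounds add up with equality. *)
  by rewrite le_eqVlt; apply/orP; left; apply/eqP; rewrite /m /n; field.
move=> x y xab ycd.
have /differentiable_eps/(_ e e0)[dl dl0 H] : differentiable F (x +i* y) by apply: dF; split.
exists (dl / 2); first by rewrite divr_gt0.
move=> a' b' c' d' /andP[h1 h2] /andP[h3 h4] h5 h6 h7 h8 h9 h10.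
have ab' := le_trans h1 h2; have cd' := le_trans h3 h4.
apply: (rectangle_integral_small e0 H) => //.
- by split; apply/andP.
- lra.
- exact: iF.
Qed.

(** The left and right strips are cut off at full height first, then the bottom and top strips of
    what remains. *)
Lemma rectangle_integral_shrink F a b c d a' b' c' d' :
  a <= a' -> a' <= b' -> b' <= b -> c <= c' -> c' <= d' -> d' <= d ->
  boundary_integrable F a b c d -> boundary_integrable F a' b c d ->
  boundary_integrable F a' b' c d -> boundary_integrable F a' b' c' d ->
  rectangle_integral F a a' c d = 0 -> rectangle_integral F b' b c d = 0 ->
  rectangle_integral F a' b' c c' = 0 -> rectangle_integral F a' b' d' d = 0 ->
  rectangle_integral F a b c d = rectangle_integral F a' b' c' d'.
Proof.
move=> aa ab bb cc cd dd i1 i2 i3 i4 z1 z2 z3 z4.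
rewrite (rectangle_integral_splitV aa (le_trans ab bb) i1) z1 add0r.
rewrite (rectangle_integral_splitV ab bb i2) z2 addr0.
rewrite (rectangle_integral_splitH cc (le_trans cd dd) i3) z3 add0r.
by rewrite (rectangle_integral_splitH cd dd i4) z4 addr0.
Qed.

(** Goursat's theorem shrinks the contour to a square of half-side [h] around [p]. There [F] is at
    most [e / h] while the contour has length [8 * h], so the integral is at most [16 * e]. *)
Lemma rectangle_integral_punctured F a b c d p :
  a < complex.Re p < b -> c < complex.Im p < d ->
  (forall s, rectangle a b c d s -> s != p -> differentiable F s) ->
  (forall e, 0 < e -> exists2 dl, 0 < dl & forall s, s != p ->
     modulus (s - p) < dl -> modulus (s - p) * modulus (F s) <= e) ->
  rectangle_integral F a b c d = 0.
Proof.
move=> /andP[ap pb] /andP[cp pd] dF Fp; apply: (@eq0_modulus_le _ 16) => e e0.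
have [dl dl0 Fdl] := Fp e e0.
set x := complex.Re p in ap pb; set y := complex.Im p in cp pd.
(* The first four terms keep the small square inside the rectangle; [dl / 4] keeps its boundary, at
   distance at most [2 * h] from [p], within [dl]. *)
pose h := Num.min (Num.min ((x - a) / 2) ((b - x) / 2))
  (Num.min (Num.min ((y - c) / 2) ((d - y) / 2)) (dl / 4)).
have h0 : 0 < h by rewrite /h !lt_min !divr_gt0 // subr_gt0.
have : h <= h by [].
rewrite {2}/h !le_min => /andP[/andP[h1 h2] /andP[/andP[h3 h4] h5]].
clearbody h.
have iF a' b' c' d' : a <= a' -> b' <= b -> c <= c' -> d' <= d -> a' <= b' -> c' <= d' ->
    x != a' -> x != b' -> y != c' -> y != d' -> boundary_integrable F a' b' c' d'.
  move=> k1 k2 k3 k4 k5 k6 /eqP n1 /eqP n2 /eqP n3 /eqP n4.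
  apply: differentiable_boundary_integrable => // s sR.
  apply: dF; first by have [sR' _] := sR; exact: sub_rectangle sR'.
  by apply/eqP => sp; move: sR; rewrite sp => -[_] [].
have gF a' b' c' d' : a <= a' -> b' <= b -> c <= c' -> d' <= d -> a' <= b' -> c' <= d' ->
    ~ rectangle a' b' c' d' p -> rectangle_integral F a' b' c' d' = 0.
  move=> k1 k2 k3 k4 k5 k6 np; apply: goursat => // s sR.
  apply: dF; first exact: sub_rectangle sR.
  by apply/eqP => sp; apply: np; rewrite -sp.
have axh : a <= x - h by clear -h1 h0; lra.
have xhb : x + h <= b by clear -h2 h0; lra.
have cyh : c <= y - h by clear -h3 h0; lra.
have yhd : y + h <= d by clear -h4 h0; lra.
have xl : x - h < x by rewrite ltrBlDr ltrDl.
have xr : x < x + h by rewrite ltrDl.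
have yl : y - h < y by rewrite ltrBlDr ltrDl.
have yr : y < y + h by rewrite ltrDl.
have xx := ltW (lt_trans xl xr); have yy := ltW (lt_trans yl yr).
have ab := ltW (lt_trans ap pb); have cd := ltW (lt_trans cp pd).
have neqs := (gt_eqF ap, lt_eqF pb, gt_eqF cp, lt_eqF pd,
  gt_eqF xl, lt_eqF xr, gt_eqF yl, lt_eqF yr).
have xlb := ltW (lt_trans xl pb); have yld := ltW (lt_trans yl pd).
have axr := ltW (lt_trans ap xr); have cyr := ltW (lt_trans cp yr).
have iS : boundary_integrable F (x - h) (x + h) (y - h) (y + h).
  by apply: iF; rewrite ?neqs.
have -> : rectangle_integral F a b c d =
    rectangle_integral F (x - h) (x + h) (y - h) (y + h).
  apply: rectangle_integral_shrink => //.
  - by apply: iF; rewrite ?neqs.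
  - by apply: iF; rewrite ?neqs.
  - by apply: iF; rewrite ?neqs.
  - by apply: iF; rewrite ?neqs.
  - by apply: gF => //; case=> /andP[_]; rewrite leNgt xl.
  - by apply: gF => //; case=> /andP[+ _]; rewrite leNgt xr.
  - by apply: gF => //; case=> _ /andP[_]; rewrite leNgt yl.
  - by apply: gF => //; case=> _ /andP[+ _]; rewrite leNgt yr.
have -> : 16 * e = 4 * (e / h) * ((x + h - (x - h)) + (y + h - (y - h))).
  by field; rewrite gt_eqF.
apply: rectangle_integral_le => // s [sR sB].
have hs : h <= modulus (s - p).
  have [->|->] : h = `|complex.Re (s - p)| \/ h = `|complex.Im (s - p)|.
    by case: sB => sE; [left|left|right|right];
      rewrite ?(ReD, ImD, ReN, ImN) -/x -/y sE addrAC subrr add0r ?normrN gtr0_norm.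
  - exact: ge_modulus_Re.
  - exact: ge_modulus_Im.
have sp : modulus (s - p) < dl.
  apply: le_lt_trans (modulus_le_ReIm _) _.
  case: sR => sx sy; rewrite ReD ReN ImD ImN -/x -/y.
  apply: (@le_lt_trans _ _ (h + h)); last by clear -h5 h0 dl0; lra.
  by apply: lerD; rewrite ler_distl.
have snp : s != p.
  by rewrite -subr_eq0 -modulus_gt0 (lt_le_trans h0).
rewrite ler_pdivlMr // mulrC; apply: le_trans (Fdl s snp sp).
by rewrite ler_wpM2r // modulus_ge0.
Qed.

End Goursat.

(** * A Cauchy estimate at the centre of a square *)

Section CauchyEstimate.
Context {R : realType}.
Implicit Types (H : R[i] -> R[i]) (r M : R) (s : R[i]).

Lemma differentiable_id_inv s : s != 0 -> differentiable (fun z : R[i] => z^-1) s.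
Proof. by move=> s0; apply: differentiableV. Qed.

Lemma inv_complexE (x y : R) : (x +i* y)^-1 =
  (x / (x ^+ 2 + y ^+ 2)) +i* (- (y / (x ^+ 2 + y ^+ 2))).
Proof. by []. Qed.

Lemma inv_boundary_integrable r : 0 < r ->
  boundary_integrable (fun s : R[i] => s^-1) (- r) r (- r) r.
Proof.
move=> r0; apply: differentiable_boundary_integrable; [lra|lra|].
move=> s [_ sB]; apply: differentiable_id_inv; apply/eqP => s0.
by move: sB; rewrite s0 /= => -[] ?; lra.
Qed.

Lemma poisson_kernel_integrable a b r : 0 < r ->
  complex_integrable a b (fun t => (4 * r / (t ^+ 2 + r ^+ 2))%:C).
Proof.
move=> r0; apply: continuous_curve_integrable => t _ e e0.
have n0 : t ^+ 2 + r ^+ 2 != 0 by rewrite gt_eqF // ltr_wpDl ?sqr_ge0 // exprn_gt0.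
have : {for t, continuous (fun t : R => 4 * r / (t ^+ 2 + r ^+ 2))}.
  apply: continuousM; first exact: cst_continuous.
  apply: continuousV => //; apply: continuousD; last exact: cst_continuous.
  by apply: exprn_continuous.
move=> /cvgrPdist_le /(_ e e0) [dl /= dl0 D]; exists dl => // t' tt'.
by rewrite modulus_realB distrC D //= distrC.
Qed.

(* On a square centred at the origin the real parts of the four sides cancel
   pointwise, and each side contributes [r / (t ^+ 2 + r ^+ 2)] to the
   imaginary part. *)
Lemma rectangle_integral_inv r : 0 < r ->
  rectangle_integral (fun s : R[i] => s^-1) (- r) r (- r) r =
  'i * complex_integral (- r) r (fun t => (4 * r / (t ^+ 2 + r ^+ 2))%:C).
Proof.
move=> r0; have [i1 i2 i3 i4] := inv_boundary_integrable r0.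
have n0 t : t ^+ 2 + r ^+ 2 != 0 by rewrite gt_eqF // ltr_wpDl ?sqr_ge0 // exprn_gt0.
rewrite /rectangle_integral -!complex_integralB //.
rewrite -complex_integralZ; last exact: complex_integrableB.
rewrite -complex_integralD; first last.
- by apply: complex_integrableZ; exact: complex_integrableB.
- exact: complex_integrableB.
rewrite -complex_integralZ.
  apply: eq_complex_integral => t _; rewrite !inv_complexE.
  have rt : r ^+ 2 + t ^+ 2 != 0 by rewrite addrC n0.
  have NN : (- r) ^+ 2 = r ^+ 2 by rewrite sqrrN.
  by apply: eq_ReIm; rewrite ?(ReD, ImD, ReM, ImM, ReN, ImN) /= ?NN; field;
    rewrite ?n0 ?rt.
exact: poisson_kernel_integrable.
Qed.

(** On [[-r, r]] one has [t ^+ 2 <= r ^+ 2], so the integrand is at least [2 / r], over a segment of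
    length [2 * r]. *)
Lemma modulus_rectangle_integral_inv r : 0 < r ->
  4 <= modulus (rectangle_integral (fun s : R[i] => s^-1) (- r) r (- r) r).
Proof.
move=> r0; rewrite rectangle_integral_inv // modulusM modulus_i mul1r.
apply: le_trans (ge_modulus_Re _); apply: le_trans (ler_norm _) => /=.
have e4 : 4 = 2 / r * (r - - r) :> R by field; rewrite gt_eqF.
rewrite [X in X <= _]e4 -Rintegral_itv_cst; last by lra.
apply: le_Rintegral => //.
- by have [] := complex_integrable_cst (- r) r (2 / r)%:C.
- by have [] := @poisson_kernel_integrable (- r) r r r0.
move=> t /=; rewrite in_itv /= => /andP[t1 t2].
have k0 : 0 < t ^+ 2 + r ^+ 2 by rewrite ltr_wpDl ?sqr_ge0 // exprn_gt0.
rewrite (ler_pdivlMr _ _ k0) mulrAC (ler_pdivrMr _ _ r0).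
have : 0 <= (r - t) * (r + t) by apply: mulr_ge0; lra.
nra.
Qed.

(* The weak maximum principle with a removable singularity at [-1]: the rough
   constant 4 replaces the sharp one because [complex_integral] is bounded
   through its real and imaginary parts. *)
Lemma punctured_square_bound H r M : 1 < r ->
  (forall s, rectangle (- r) r (- r) r s -> s != -1 -> differentiable H s) ->
  (forall e, 0 < e -> exists2 dl, 0 < dl & forall s, s != -1 ->
     modulus (s + 1) < dl -> modulus (s + 1) * modulus (H s) <= e) ->
  (forall s, rectangle_boundary (- r) r (- r) r s -> modulus (H s) <= M) ->
  modulus (H 0) <= 4 * M.
Proof.
move=> r1 dH H1 HM; have r0 : 0 < r by lra.
(* This is the difference quotient [(H s - H 0) / s]. Its contour integral vanishes, which is
   Cauchy's formula at 0. *)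
pose T s := s^-1 * H s - H 0 * s^-1.
have bd0 s : rectangle_boundary (- r) r (- r) r s -> s != 0.
  by move=> [_ sB]; apply/eqP => s0; move: sB; rewrite s0 /= => -[] ?; lra.
have bd1 s : rectangle_boundary (- r) r (- r) r s -> s != -1.
  by move=> [_ sB]; apply/eqP => s0; move: sB; rewrite s0 /= ?oppr0 => -[] ?; lra.
have dT s : rectangle (- r) r (- r) r s -> s != 0 -> s != -1 -> differentiable T s.
  move=> sR s0 s1; apply: differentiableB; apply: differentiableM.
  - exact: differentiable_id_inv.
  - exact: dH.
  - exact: differentiable_cst.
  - exact: differentiable_id_inv.
have iT : boundary_integrable T (- r) r (- r) r.
  apply: differentiable_boundary_integrable; [lra|lra|] => s sB.
  by apply: dT; [case: sB | exact: bd0 | exact: bd1].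
have iH : boundary_integrable (fun s => s^-1 * H s) (- r) r (- r) r.
  apply: differentiable_boundary_integrable; [lra|lra|] => s sB.
  apply: differentiableM; first by apply: differentiable_id_inv; exact: bd0.
  by apply: dH; [case: sB | exact: bd1].
have iV := inv_boundary_integrable r0.
have T0 : rectangle_integral T (- r) r (- r) r = 0.
  (* The cut along real part [- 2^-1] separates the singularities 0 and -1, so that each half has a
     single puncture. *)
  rewrite (@rectangle_integral_splitV _ T (- r) (- 2^-1)) ?[X in X + _](_ : _ = 0);
    [rewrite add0r| |lra|lra|exact: iT].
  - apply: (@rectangle_integral_punctured _ T _ _ _ _ 0) => /=; [lra|lra| |].
      move=> s sR s0; apply: dT => //; first by apply: sub_rectangle sR; lra.
      by apply/eqP => s1; case: sR; rewrite s1 /= => /andP[]; lra.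
    move=> e e0; have /differentiable_lipschitz_at[K K0 [dl dl0 L]] : differentiable H 0.
      apply: dH; first by split => /=; apply/andP; split; lra.
      by rewrite eq_sym oppr_eq0 oner_eq0.
    exists (Num.min dl (e / K)) => [|s s0]; first by rewrite lt_min dl0 divr_gt0.
    rewrite lt_min => /andP[/L]; rewrite subr0 => h /ltW h'.
    rewrite -modulusM /T mulrBr mulrA mulrCA divff // mul1r mulr1.
    by apply: le_trans h _; rewrite mulrC -ler_pdivlMr.
  - apply: (@rectangle_integral_punctured _ T _ _ _ _ (-1)) => /=; [lra|lra| |].
      move=> s sR s1; apply: dT => //; first by apply: sub_rectangle sR; lra.
      by apply/eqP => s0; case: sR; rewrite s0 /= => /andP[]; lra.
    move=> e e0; have [dl dl0 L] := H1 (e / 4) (divr_gt0 e0 (ltr0n _ 4)).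
    pose K := 2 * modulus (H 0) + 1; have K0 : 0 < K.
      by rewrite /K ltr_wpDl // mulr_ge0 // modulus_ge0.
    (* Within [2^-1] of -1 the factor [s^-1] is at most 2; the terms with [H s] and with [H 0] then
       contribute at most [e / 2] each. *)
    exists (Num.min (Num.min dl 2^-1) (e / 2 / K)) => [|s s1].
      by rewrite !lt_min dl0 invr_gt0 ltr0n /= !divr_gt0.
    rewrite !lt_min opprK => /andP[/andP[h1 h2] h3].
    have h4 := L s s1 h1.
    have h5 : 2^-1 <= modulus s.
      have := modulusB (s + 1) s; rewrite addrC addKr (modulus_nat 1); lra.
    have h6 : modulus s^-1 <= 2 by rewrite modulusV -[2]invrK lef_pV2 ?posrE //; lra.
    have -> : T s = s^-1 * (H s - H 0) by rewrite /T; ring.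
    rewrite modulusM.
    have h7 := modulusB (H s) (H 0).
    have h8 := modulus_ge0 (s + 1); have h9 := modulus_ge0 (H s - H 0).
    have {}h3 : modulus (s + 1) * K <= e / 2 by rewrite -ler_pdivlMr // ltW.
    have h10 := modulus_ge0 s^-1; have h11 := modulus_ge0 (H 0).
    have h12 : modulus (s + 1) * (modulus s^-1 * modulus (H s - H 0)) <=
        modulus (s + 1) * (2 * (modulus (H s) + modulus (H 0))).
      by apply: ler_wpM2l => //; apply: ler_pM.
    apply: le_trans h12 _; rewrite /K in h3; nra.
have E : H 0 * rectangle_integral (fun s => s^-1) (- r) r (- r) r =
    rectangle_integral (fun s => s^-1 * H s) (- r) r (- r) r.
  move: T0; rewrite /T rectangle_integralB //; last first.
    by case: iV => ? ? ? ?; split; exact: complex_integrableZ.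
  by rewrite rectangle_integralZ // => /eqP; rewrite subr_eq0 => /eqP ->.
(* On the boundary [modulus s >= r], so the integral is at most [16 * M]; dividing by the lower
   bound 4 for the integral of [s^-1] gives the constant of the statement. *)
have : modulus (rectangle_integral (fun s => s^-1 * H s) (- r) r (- r) r) <=
    4 * (M / r) * ((r - - r) + (r - - r)).
  apply: rectangle_integral_le; [lra|lra|exact: iH|].
  move=> s sB; rewrite modulusM modulusV mulrC.
  have rs : r <= modulus s.
    case: (sB) => [_ [] sE].
    - by apply: le_trans (ge_modulus_Re _); rewrite sE normrN ler_norm.
    - by apply: le_trans (ge_modulus_Re _); rewrite sE ler_norm.
    - by apply: le_trans (ge_modulus_Im _); rewrite sE normrN ler_norm.
    - by apply: le_trans (ge_modulus_Im _); rewrite sE ler_norm.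
  apply: ler_pM; rewrite ?invr_ge0 ?modulus_ge0 // ?HM //.
  by rewrite lef_pV2 ?posrE // (lt_le_trans r0).
have -> : 4 * (M / r) * ((r - - r) + (r - - r)) = 16 * M by field; rewrite gt_eqF.
rewrite -E modulusM; have := modulus_rectangle_integral_inv r0.
have := modulus_ge0 (H 0); nra.
Qed.

End CauchyEstimate.

(** * Schwarz lemmas of order one and two for maps from a square to the half-plane *)

Section SchwarzEstimates.
Context {R : realType}.
Implicit Types (a w s : R[i]).

Lemma ImJ a : complex.Im a^* = - complex.Im a.
Proof. by case: a. Qed.

Lemma subJ_eq w a : w - a^* = w - a + 'i * (2 * complex.Im a)%:C.
Proof.
by apply: eq_ReIm; case: a w => x y [u v] /=; rewrite ?(ReD, ImD, ReM, ImM, ReN, ImN) /=; ring.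
Qed.

Lemma modulus_subJ_ge w a : 0 < complex.Im w -> complex.Im a <= modulus (w - a^*).
Proof.
move=> w0; apply: le_trans (ge_modulus_Im _); apply: le_trans (ler_norm _).
by rewrite ImD ImN ImJ opprK lerDr ltW.
Qed.

Lemma subJ_neq0 w a : 0 < complex.Im w -> 0 < complex.Im a -> w - a^* != 0.
Proof. by move=> w0 a0; rewrite -modulus_gt0 (lt_le_trans a0) ?modulus_subJ_ge. Qed.

(** The conformal map of the upper half-plane onto the unit disc that sends [a] to 0. *)
Definition cayley a w := (w - a) / (w - a^*).

(** The squared moduli of denominator and numerator differ by [4 * Im w * Im a], which is
    positive. *)
Lemma cayley_le1 a w : 0 < complex.Im w -> 0 < complex.Im a -> modulus (cayley a w) <= 1.
Proof.
move=> w0 a0; have n0 := subJ_neq0 w0 a0.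
rewrite modulusM modulusV ler_pdivrMr ?modulus_gt0 // mul1r.
rewrite -(@ler_pXn2r _ 2) ?nnegrE ?modulus_ge0 // !sqr_modulus.
rewrite !(ReD, ImD, ReN, ImN) ImJ opprK.
have -> : complex.Re a^* = complex.Re a by case: (a).
rewrite lerD2l; nra.
Qed.

Lemma cayleyE a w : 0 < complex.Im w -> 0 < complex.Im a ->
  w - a = cayley a w * (w - a + 'i * (2 * complex.Im a)%:C).
Proof. by move=> w0 a0; rewrite -subJ_eq divfK ?subJ_neq0. Qed.

Lemma modulus_2iIm a : 0 < complex.Im a ->
  modulus ('i * (2 * complex.Im a)%:C) = 2 * complex.Im a.
Proof.
by move=> a0; rewrite modulusM modulus_i mul1r modulus_real gtr0_norm // mulr_gt0.
Qed.

(** With [c = cayley a w], the identity [cayleyE] gives [|w - a| * (1 - |c|) <= 2 * Im a * |c|], and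
    [1 - |c| >= 2^-1]. *)
Lemma cayley_half a w : 0 < complex.Im w -> 0 < complex.Im a ->
  modulus (cayley a w) <= 2^-1 ->
  modulus (w - a) <= 4 * complex.Im a * modulus (cayley a w).
Proof.
move=> w0 a0 c2; have := congr1 modulus (cayleyE w0 a0); rewrite modulusM => E.
have := modulusD (w - a) ('i * (2 * complex.Im a)%:C); rewrite modulus_2iIm // => D.
have := modulus_ge0 (cayley a w); have := modulus_ge0 (w - a).
nra.
Qed.

Section Square.
Variables (phi : R[i] -> R[i]) (r : R).
Hypothesis r16 : 16 <= r.
Hypothesis dphi : forall s, rectangle (- r) r (- r) r s -> differentiable phi s.
Hypothesis Iphi : forall s, rectangle (- r) r (- r) r s -> 0 < complex.Im (phi s).

(** A map to the unit disc that vanishes at -1. The base point is -1 because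
    [punctured_square_bound] estimates at the centre 0 and admits a singularity at -1. *)
Let psi s := cayley (phi (-1)) (phi s).
Let y := complex.Im (phi (-1)).

Let N1R : rectangle (- r) r (- r) r (-1).
Proof. by have := r16; split; rewrite ?(ReN, ImN) /=; apply/andP; split; lra. Qed.

Let OR : rectangle (- r) r (- r) r 0.
Proof. by have := r16; split => /=; apply/andP; split; lra. Qed.

Let y0 : 0 < y. Proof. exact: Iphi. Qed.

Let psi1 s : rectangle (- r) r (- r) r s -> modulus (psi s) <= 1.
Proof. by move=> sR; rewrite cayley_le1 // Iphi. Qed.

Let dpsi s : rectangle (- r) r (- r) r s -> differentiable psi s.
Proof.
move=> sR; apply: differentiableM; first by apply: differentiableB => //; exact: dphi.
apply: differentiableV; first by apply: differentiableB => //; exact: dphi.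
by rewrite subJ_neq0 // Iphi.
Qed.

Let boundary_far s : rectangle_boundary (- r) r (- r) r s -> r / 2 <= modulus (s + 1).
Proof.
have r1 := r16; case=> _ sB.
have R1 : complex.Re (1 : R[i]) = 1 by [].
have I1 : complex.Im (1 : R[i]) = 0 by [].
have [h1|h1] : r / 2 <= `|complex.Re (s + 1)| \/ r / 2 <= `|complex.Im (s + 1)|.
  by case: sB => sE; [left|left|right|right]; rewrite ?ReD ?ImD sE ?R1 ?I1 ler_normr;
    apply/orP; first [left; lra | right; lra].
  exact: le_trans (ge_modulus_Re _).
exact: le_trans (ge_modulus_Im _).
Qed.

(** As in the Schwarz lemma, [psi] is divided by [s + 1]. The quotient is at most [2 / r] on the
    boundary, and the maximum principle costs a factor 4. *)
Let psi_small : modulus (psi 0) <= 8 / r.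
Proof.
have r1 := r16; pose H s := psi s / (s + 1).
have -> : psi 0 = H 0 by rewrite /H add0r divr1.
have -> : 8 / r = 4 * (2 / r) by ring.
have r0 : 0 < r by lra.
have dH s : rectangle (- r) r (- r) r s -> s != -1 -> differentiable H s.
  move=> sR s1; apply: differentiableM; first exact: dpsi.
  by apply: differentiableV; [exact: differentiableD | rewrite addr_eq0].
apply: (punctured_square_bound (r := r) _ dH); first by lra.
  have /differentiable_lipschitz_at[K K0 [dl dl0 L]] := dpsi N1R.
  move=> e e0; exists (Num.min dl (e / K)) => [|s s1]; first by rewrite lt_min dl0 divr_gt0.
  rewrite lt_min -modulusM /H mulrCA divff ?addr_eq0 // mulr1 => /andP[h1 h2].
  have : modulus (s - -1) < dl by rewrite opprK.
  move=> /L; rewrite opprK {2}/psi /cayley subrr mul0r subr0 => h3; apply: le_trans h3 _.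
  by rewrite mulrC -ler_pdivlMr // ltW.
move=> s sB; have h := boundary_far sB; case: sB => sR _.
rewrite modulusM modulusV -[2 / r]mul1r; apply: ler_pM; rewrite ?modulus_ge0 //.
- by rewrite invr_ge0 modulus_ge0.
- exact: psi1.
- by rewrite -[2 / r]invf_div lef_pV2 ?posrE ?(lt_le_trans _ h) // divr_gt0.
Qed.

Let psi_half : modulus (psi 0) <= 2^-1.
Proof.
have r1 := r16; apply: le_trans psi_small _; rewrite ler_pdivrMr; lra.
Qed.

Lemma schwarz_oscillation : modulus (phi 0 - phi (-1)) <= 2 * complex.Im (phi (-1)).
Proof.
apply: le_trans (cayley_half (Iphi OR) (Iphi N1R) psi_half) _.
rewrite -/y; move: psi_half; rewrite /psi => h; have := y0; nra.
Qed.

(** The first-order part of [psi] at -1 is removed and the rest divided by [(s + 1) ^+ 2]; the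
    maximum principle then bounds [psi 0] minus that part by [O(r ^- 2)], and inverting the Cayley
    transform carries this over to [phi]. The hypothesis bounds the derivative of [psi] at -1 by
    [1 / r]. *)
Lemma schwarz_second_order : modulus ('d phi (-1 : R[i]) 1) * r <= 2 * complex.Im (phi (-1)) ->
  modulus (phi 0 - phi (-1) - 'd phi (-1 : R[i]) 1) <= 304 * complex.Im (phi (-1)) / r ^+ 2.
Proof.
rewrite -/y => d_small; have r1 := r16; have r0 : 0 < r by lra.
set d := 'd phi (-1 : R[i]) 1 in d_small *; set iy := 'i * (2 * y)%:C.
have miy : modulus iy = 2 * y by rewrite modulus_2iIm // y0.
have iy0 : iy != 0 by rewrite -modulus_gt0 miy mulr_gt0 // y0.
(* This is the derivative of [psi] at -1, since [cayley a] has derivative [1 / (2 i Im a)] at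
   [a]. *)
pose dt := d / iy.
have dtE : dt * iy = d by rewrite divfK.
have dt_small : modulus dt * r <= 1.
  rewrite modulusM modulusV miy mulrAC ler_pdivrMr ?mul1r //.
  by rewrite mulr_gt0 // y0.
clearbody dt.
pose H s := (psi s - dt * (s + 1)) / (s + 1) ^+ 2.
have H0E : H 0 = psi 0 - dt by rewrite /H add0r expr1n divr1 mulr1.
have HB : modulus (psi 0 - dt) <= 24 / r ^+ 2.
  have -> : 24 / r ^+ 2 = 4 * (6 / r ^+ 2) by ring.
  rewrite -H0E.
  apply: (@punctured_square_bound _ H r); first by lra.
  - move=> s sR s1; apply: differentiableM.
      apply: differentiableB; first exact: dpsi.
      by apply: differentiableM => //; exact: differentiableD.
    apply: differentiableV; last by rewrite expf_neq0 // addr_eq0.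
    by under [fun _ => _]funext do rewrite expr2; apply: differentiableM; exact: differentiableD.
  - move=> e e0.
    have Ny := y0; have k0 : 0 < e * y / 2 by rewrite divr_gt0 // mulr_gt0.
    have [K K0 [d1 d10 L]] := differentiable_lipschitz_at (dphi N1R).
    have [d2 d20 D] := differentiable_eps (dphi N1R) k0.
    have C0 : 0 < K * (modulus dt + 1) by rewrite mulr_gt0 // ltr_wpDl ?modulus_ge0.
    (* The bound 1 keeps [s] in the square, so that [phi s] lies in the half-plane; the last term
       makes the product of [dt * (s + 1)] and [phi s - phi (-1)] at most
       [e * y / 2 * modulus (s + 1)]. *)
    exists (Num.min (Num.min d1 d2) (Num.min 1 (e * y / 2 / (K * (modulus dt + 1)))))
      => [|s s1]; first by rewrite !lt_min d10 d20 ltr01 divr_gt0.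
    rewrite !lt_min => /andP[/andP[h1 h2] /andP[h3 h4]].
    have {}L := L s; have {}D := D s; rewrite !opprK -/d in L D.
    have {L h1} L := L h1; have {D h2} D := D h2.
    have Is : 0 < complex.Im (phi s).
      apply: Iphi; have := ge_modulus_Re (s + 1); have := ge_modulus_Im (s + 1).
      have R1 : complex.Re (1 : R[i]) = 1 by [].
      have I1 : complex.Im (1 : R[i]) = 0 by [].
      rewrite ReD ImD R1 I1 addr0.
      move=> /le_lt_trans/(_ h3); rewrite ltr_norml => /andP[? ?].
      move=> /le_lt_trans/(_ h3); rewrite ltr_norml => /andP[? ?].
      by split; apply/andP; split; lra.
    have n0 := subJ_neq0 Is (Iphi N1R).
    have yle := modulus_subJ_ge (phi (-1)) Is; rewrite -/y in yle.
    have s10 : s + 1 != 0 by rewrite addr_eq0.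
    have m0 : 0 < modulus (s + 1) by rewrite modulus_gt0.
    have mj0 : 0 < modulus (phi s - (phi (-1))^*) by exact: lt_le_trans yle.
    rewrite -modulusM.
    (* The numerator becomes the first-order error of [phi] minus a second-order product, each at
       most [e * y / 2 * modulus (s + 1)]; the denominator is at least [y * modulus (s + 1)] in
       modulus. *)
    have -> : (s + 1) * H s = ((phi s - phi (-1) - d * (s + 1)) -
        dt * (s + 1) * (phi s - phi (-1))) / (phi s - (phi (-1))^*) / (s + 1).
      rewrite /H /psi /cayley -dtE.
      have -> : phi s - phi (-1) - dt * iy * (s + 1) - dt * (s + 1) * (phi s - phi (-1)) =
          phi s - phi (-1) - dt * (s + 1) * (phi s - (phi (-1))^*).
        by rewrite subJ_eq -/y -/iy; ring.
      by field; rewrite s10 n0.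
    rewrite !modulusM !modulusV !ler_pdivrMr //.
    apply: le_trans (modulusB _ _) _; rewrite !modulusM.
    have dt0 := modulus_ge0 dt; have dp0 := modulus_ge0 (phi s - phi (-1)).
    rewrite (ltr_pdivlMr _ _ C0) in h4.
    have h5 : modulus dt * modulus (s + 1) * modulus (phi s - phi (-1)) <=
        modulus dt * modulus (s + 1) * (K * modulus (s + 1)).
      by rewrite ler_wpM2l // mulr_ge0 // ltW.
    have h6 : modulus dt * modulus (s + 1) * (K * modulus (s + 1)) <=
        e * y / 2 * modulus (s + 1).
      rewrite mulrA ler_wpM2r ?(ltW m0) //; apply: le_trans (ltW h4).
      rewrite mulrDr mulr1 mulrDr [X in X <= _](_ : _ = modulus (s + 1) * (K * modulus dt));
        last by ring.
      by rewrite lerDl mulr_ge0 // ltW.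
    have h7 : e * modulus (s + 1) * y <=
        e * modulus (s + 1) * modulus (phi s - (phi (-1))^*).
      by rewrite ler_wpM2l // mulr_ge0 // ltW.
    lra.
  move=> s sB; have h := boundary_far sB; case: sB => sR _.
  have s0 : 0 < modulus (s + 1) by apply: lt_le_trans h; lra.
  have -> : H s = psi s * ((s + 1)^-1) ^+ 2 - dt * (s + 1)^-1.
    by rewrite /H; field; rewrite -modulus_gt0.
  apply: le_trans (modulusB _ _) _; 
  rewrite (modulusM (psi s)) (modulusM dt) expr2 (modulusM (s + 1)^-1) modulusV.
  have v2 : (modulus (s + 1))^-1 <= 2 / r.
    by rewrite -[2 / r]invf_div lef_pV2 ?posrE ?(lt_le_trans _ h) // divr_gt0.
  have v0 : 0 <= (modulus (s + 1))^-1 by rewrite invr_ge0 modulus_ge0.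
  (* The term with [psi] contributes 4 and the term with [dt] contributes 2. *)
  have -> : 6 / r ^+ 2 = 1 * (2 / r * (2 / r)) + r^-1 * (2 / r) by field; lra.
  apply: lerD.
    apply: ler_pM; rewrite ?mulr_ge0 ?modulus_ge0 ?psi1 //.
    by apply: ler_pM.
  apply: ler_pM; rewrite ?modulus_ge0 //.
  by rewrite -[r^-1]mul1r ler_pdivlMr.
have E := cayleyE (Iphi OR) (Iphi N1R); rewrite -/(psi 0) -/y -/iy in E.
(* The identity [cayleyE] at 0, from which [d = dt * iy] is subtracted; the second summand is a
   product of two quantities of order [1 / r]. *)
have -> : phi 0 - phi (-1) - d = iy * (psi 0 - dt) + psi 0 * (phi 0 - phi (-1)).
  by rewrite mulrBr [iy * dt]mulrC dtE {1}E; ring.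
apply: le_trans (modulusD _ _) _.
rewrite (modulusM iy) (modulusM (psi 0)) miy.
have D := cayley_half (Iphi OR) (Iphi N1R) psi_half; rewrite -/(psi 0) -/y in D.
have -> : 304 * y / r ^+ 2 = 2 * y * (24 / r ^+ 2) + (8 / r) * (4 * y * (8 / r)).
  by field; lra.
have y0' := y0.
apply: lerD; first by rewrite ler_wpM2l //; lra.
apply: ler_pM; rewrite ?modulus_ge0 //; apply: le_trans D _.
by rewrite ler_wpM2l //; lra.
Qed.

End Square.
End SchwarzEstimates.

(** * Restriction to complex lines *)

Section Lines.
Context {R : realType} {n : nat}.
Implicit Types (f : 'rV[R[i]]_n -> R[i]) (a b v z : 'rV[R[i]]_n) (s l : R[i]).

(** The parameter [s + 1] puts the base point [a] at -1 and the target [a + v] at 0, as in the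
    Schwarz estimates. *)
Lemma differentiable_line f a v s : differentiable f (a + (s + 1) *: v) ->
  differentiable (fun s => f (a + (s + 1) *: v)) s.
Proof.
move=> df.
have ds : differentiable (fun s : R[i] => s + 1) s by exact: differentiableD.
have dv := differentiableZl v ds.
have da := differentiableD (differentiable_cst a s) dv.
have {}da : differentiable (fun s : R[i] => a + (s + 1) *: v) s by exact: da.
have := @differentiable_comp _ _ _ _ (fun s : R[i] => a + (s + 1) *: v) f s da.
by apply.
Qed.

Lemma derive_line f a v :
  'D_1 (fun s : R[i] => f (a + (s + 1) *: v)) (-1 : R[i]) = 'D_v f a.
Proof.
set g := fun s : R[i] => f (a + (s + 1) *: v).
have E : (fun h : R[i] => h^-1 *: ((g \o shift (-1)) (h *: (1 : R[i])) - g (-1))) =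
    (fun h => h^-1 *: ((f \o shift a) (h *: v) - f a)).
  apply/funext => h; rewrite /g /=; have -> : h *: (1 : R[i]) = h by exact: mulr1.
  by rewrite subrK addNr scale0r addr0 [a + _]addrC.
by rewrite /derive E.
Qed.

Lemma diff_partial f a v : differentiable f a ->
  'd f a v = \sum_(j < n) v ord0 j * partial_derivative j f a.
Proof.
move=> df; rewrite {1}(row_sum_delta v) linear_sum; apply: eq_bigr => j _.
by rewrite linearZ /partial_derivative deriveE.
Qed.

Definition height_ge m z := forall j, m <= complex.Im (z ord0 j).

Lemma height_upper m z : 0 < m -> height_ge m z -> upper_half_space n z.
Proof. by move=> m0 zm j; rewrite /upper_half_plane /= (lt_le_trans m0). Qed.

(** On the square [modulus (s + 1) <= 3 * r], so no coordinate moves by as much as [m]. *)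
Lemma line_upper m B r a v s : 0 < m -> 1 <= r -> height_ge m a ->
  (forall j, modulus (v ord0 j) <= B) -> 3 * r * B < m ->
  rectangle (- r) r (- r) r s -> upper_half_space n (a + (s + 1) *: v).
Proof.
move=> m0 r1 am vB rB [/andP[s1 s2] /andP[s3 s4]] j.
rewrite /upper_half_plane /= !mxE ImD.
have B0 : 0 <= B := le_trans (modulus_ge0 _) (vB j).
have h1 : modulus (s + 1) <= 3 * r.
  apply: le_trans (modulus_le_ReIm _) _.
  have R1 : complex.Re (1 : R[i]) = 1 by [].
  have I1 : complex.Im (1 : R[i]) = 0 by [].
  rewrite ReD ImD R1 I1 addr0.
  have : `|complex.Re s + 1| <= r + 1 by rewrite ler_norml; apply/andP; split; lra.
  have : `|complex.Im s| <= r by rewrite ler_norml; apply/andP; split; lra.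
  lra.
have h2 : modulus ((s + 1) * v ord0 j) <= 3 * r * B.
  by rewrite modulusM; apply: ler_pM; rewrite ?modulus_ge0.
have := ge_modulus_Im ((s + 1) * v ord0 j); rewrite ler_norml => /andP[h3 _].
have := am j; lra.
Qed.

Lemma modulus_mean_le B z : (0 < n)%N -> (forall j, modulus (z ord0 j) <= B) ->
  modulus (mean n z) <= B.
Proof.
move=> n0 zB; rewrite /mean modulusM modulusV modulus_nat mulrC.
rewrite ler_pdivrMr ?ltr0n //.
have -> : B * n%:R = \sum_(j < n) B by rewrite sumr_const card_ord mulr_natr.
apply: (big_ind2 (fun (x : R[i]) (y : R) => modulus x <= y)) => //.
  by rewrite modulus0.
by move=> x1 x2 y1 y2 h1 h2; apply: le_trans (modulusD _ _) (lerD h1 h2).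
Qed.

Section HalfSpaceMap.
Variables (f : 'rV[R[i]]_n -> R[i]).
Hypothesis df : holomorphic_on (@upper_half_space R n) f.
Hypothesis If : forall z, upper_half_space n z -> upper_half_plane (f z).

(** The first-order Schwarz estimate on the square of half-side 16, whence [48 = 3 * 16]. *)
Lemma oscillation_le m B a v : 0 < m -> height_ge m a ->
  (forall j, modulus (v ord0 j) <= B) -> 48 * B < m ->
  modulus (f (a + v) - f a) <= 2 * complex.Im (f a).
Proof.
move=> m0 am vB Bm; pose phi s := f (a + (s + 1) *: v).
have lu s : rectangle (- 16) 16 (- 16) 16 s -> upper_half_space n (a + (s + 1) *: v).
  by apply: (@line_upper m B 16) => //; lra.
have -> : f (a + v) = phi 0 by rewrite /phi add0r scale1r.
have -> : f a = phi (-1) by rewrite /phi addNr scale0r addr0.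
apply: (@schwarz_oscillation _ phi 16) => // s /lu su.
  by apply: differentiable_line; exact: df.
exact: If.
Qed.

(** The segment is cut into [N] equal steps, at height at least [m] by convexity. Each step moves
    [f] by at most twice its current height, which the left-hand side dominates, so this side at
    most triples. *)
Lemma chain_le m B N a v : 0 < m -> height_ge m a -> height_ge m (a + v) ->
  (forall j, modulus (v ord0 j) <= B) -> 48 * B < m * N%:R ->
  modulus (f (a + v) - f a) + complex.Im (f a) <= 3 ^+ N * complex.Im (f a).
Proof.
move=> m0 am avm vB Bm.
have [N0|N0] := posnP N.
  (* With [N = 0] the bound [B] is negative, so there are no coordinates at all. *)
  have -> : v = 0.
    apply/rowP => j; exfalso; have := vB j; have := modulus_ge0 (v ord0 j).
    by rewrite N0 mulr0 in Bm; lra.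
  by rewrite addr0 subrr modulus0 add0r N0 expr0 mul1r.
pose u : 'rV[R[i]]_n := (N%:R^-1 : R)%:C *: v.
have kE k : k%:R *: u = (k%:R / N%:R : R)%:C *: v.
  by rewrite /u scalerA rmorphM rmorph_nat.
have step k : (k <= N)%N ->
    modulus (f (a + k%:R *: u) - f a) + complex.Im (f a) <= 3 ^+ k * complex.Im (f a).
  elim: k => [|k IH] kN.
    by rewrite scale0r addr0 subrr modulus0 add0r expr0 mul1r.
  have {}IH := IH (ltnW kN).
  have hk : height_ge m (a + k%:R *: u).
    move=> j; have := am j; have := avm j; rewrite kE !mxE !ImD ImM /= mul0r addr0.
    have t0 : 0 <= k%:R / N%:R :> R by rewrite divr_ge0.
    have t1 : k%:R / N%:R <= 1 :> R by rewrite ler_pdivrMr ?ltr0n // mul1r ler_nat ltnW.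
    nra.
  have uB j : modulus (u ord0 j) <= B / N%:R.
    by rewrite !mxE modulusM modulus_real ger0_norm ?invr_ge0 // mulrC ler_wpM2r ?invr_ge0.
  have BN : 48 * (B / N%:R) < m by rewrite mulrA ltr_pdivrMr ?ltr0n.
  have := oscillation_le m0 hk uB BN.
  have -> : a + k%:R *: u + u = a + k.+1%:R *: u.
    by rewrite -addrA -{2}[u]scale1r -scalerDl natr1.
  set w := f (a + k.+1%:R *: u); set w' := f (a + k%:R *: u) in IH *.
  have := modulusD (w - w') (w' - f a); rewrite subrKA.
  have := ge_modulus_Im (w' - f a); rewrite ImD ImN ler_norml => /andP[_].
  rewrite exprS -mulrA; lra.
by have := step N (leqnn N); rewrite kE divff ?scale1r // pnatr_eq0 -lt0n.
Qed.

(** The conditions on the diagonal give the restriction to the line the value [l] and the derivative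
    [mean n z] at the base point. Half-side [r = Im l / (4 * B)] keeps the square in the half-space,
    and [4864 = 304 * 16]. *)
Lemma diagonal_second_order B l z : 0 < B -> (0 < n)%N ->
  (forall l, upper_half_plane l -> f (const_mx l) = l) ->
  (forall l j, upper_half_plane l -> partial_derivative j f (const_mx l) = n%:R^-1) ->
  (forall j, modulus (z ord0 j) <= B) -> 64 * B <= complex.Im l ->
  modulus (f (const_mx l + z) - l - mean n z) <= 4864 * B ^+ 2 / complex.Im l.
Proof.
move=> B0 n0 fl dfl zB lB.
have y0 : 0 < complex.Im l by lra.
pose r := complex.Im l / (4 * B).
have r16 : 16 <= r by rewrite /r ler_pdivlMr ?mulr_gt0 //; lra.
have lm : height_ge (complex.Im l) (const_mx l) by move=> j; rewrite mxE.
pose phi s := f (const_mx l + (s + 1) *: z).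
have lu s : rectangle (- r) r (- r) r s -> upper_half_space n (const_mx l + (s + 1) *: z).
  apply: (@line_upper (complex.Im l) B r) => //; first by lra.
  have -> : 3 * r * B = 3 / 4 * complex.Im l by rewrite /r; field; lra.
  lra.
have lU : upper_half_space n (const_mx l) by apply: height_upper lm.
have d : differentiable phi (-1 : R[i]).
  by apply: differentiable_line; apply: df; rewrite addNr scale0r addr0.
have dE : 'd phi (-1 : R[i]) 1 = mean n z.
  rewrite -deriveE // /phi derive_line deriveE; last exact: df.
  rewrite diff_partial; last exact: df.
  rewrite /mean mulr_sumr; apply: eq_bigr => j _.
  by rewrite dfl // mulrC.
have p0 : f (const_mx l + z) = phi 0 by rewrite /phi add0r scale1r.
have p1 : l = phi (-1) by rewrite /phi addNr scale0r addr0 fl.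
have := @schwarz_second_order _ phi r r16; rewrite dE -p0 -p1.
have -> : 304 * complex.Im l / r ^+ 2 = 4864 * B ^+ 2 / complex.Im l.
  by rewrite /r; field; rewrite !gt_eqF.
apply.
- by move=> s /lu su; apply: differentiable_line; exact: df.
- by move=> s /lu /If.
- apply: (@le_trans _ _ (B * r)).
    by rewrite ler_wpM2r ?modulus_mean_le //; lra.
  rewrite /r; have -> : B * (complex.Im l / (4 * B)) = complex.Im l / 4 by field; lra.
  lra.
Qed.

End HalfSpaceMap.
End Lines.

(** * Shifting the segment of integration and estimating the average *)

Section Averages.
Context {R : realType} {n : nat}.
Variable f : 'rV[R[i]]_n -> R[i].
Hypotheses (n_gt0 : (0 < n)%N) (fC : class_C n f).

Let df : holomorphic_on (@upper_half_space R n) f. Proof. by case: fC. Qed.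
Let If z : upper_half_space n z -> upper_half_plane (f z).
Proof. by case: fC => _ + _ _; apply. Qed.
Let fl l : upper_half_plane l -> f (const_mx l) = l.
Proof. by case: fC => _ _ + _; apply. Qed.
Let dfl l j : upper_half_plane l -> partial_derivative j f (const_mx l) = n%:R^-1.
Proof. by case: fC => _ _ _; apply. Qed.

Lemma differentiable_diagonal (z : 'rV[R[i]]_n) (w : R[i]) :
  upper_half_space n (z - const_mx w) ->
  differentiable (fun w => f (z - const_mx w)) w.
Proof.
move=> zw.
have E s : z - const_mx s = (z + const_mx 1) + (s + 1) *: const_mx (-1).
  by apply/rowP => j; rewrite !mxE; ring.
have -> : (fun w => f (z - const_mx w)) =
    (fun s => f ((z + const_mx 1) + (s + 1) *: const_mx (-1))).
  by apply/funext => s; rewrite E.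
by apply: differentiable_line; apply: df; rewrite -E.
Qed.

(** The first term comes from the bottom side, the second from the two vertical sides. The first
    does not involve [r], so [Y] can be fixed before [N], and [r] taken large last. *)
Lemma average_sub_mean_le (m B Y r : R) N (z : 'rV[R[i]]_n) :
  0 < m -> m <= B -> height_ge m z -> (forall j, modulus (z ord0 j) <= B) ->
  64 * B <= Y -> 48 * (2 * B + Y) < m * N%:R -> 0 < r ->
  modulus (average f r z - mean n z) <=
  9728 * B ^+ 2 / Y + 2 * Y * (3 ^+ N * B + 2 * B + Y) / r.
Proof.
move=> m0 mB zm zB BY YN r0.
have B0 : 0 < B by lra.
have Y0 : 0 < Y by lra.
pose G (w : R[i]) := f (z - const_mx w) + (w - mean n z).
have zw (w : R[i]) : complex.Im w <= 0 -> height_ge m (z - const_mx w).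
  by move=> w0 j; rewrite !mxE ImD ImN; have := zm j; lra.
have dG w : rectangle (- r) r (- Y) 0 w -> differentiable G w.
  move=> [_ /andP[_ w0]]; apply: differentiableD; last exact: differentiableB.
  by apply: differentiable_diagonal; exact: height_upper (zw w w0).
have iG : boundary_integrable G (- r) r (- Y) 0.
  by apply: differentiable_boundary_integrable; [lra|lra|] => s [+ _]; exact: dG.
have [iG1 iG2 iG3 iG4] := iG.
have G0 : rectangle_integral G (- r) r (- Y) 0 = 0 by apply: goursat => //; lra.
(* The value at [z - w] is compared with that at the diagonal point [l], whose real part follows
   [- w]; the chain to it has a length independent of the real part of [w]. *)
have side w : - Y <= complex.Im w <= 0 -> modulus (G w) <= 3 ^+ N * B + 2 * B + Y.
  move=> /andP[w1 w2].
  pose l : R[i] := (- complex.Re w) +i* B.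
  have hl : height_ge m (const_mx l : 'rV[R[i]]_n) by move=> j; rewrite mxE.
  pose v := z - const_mx w - const_mx l.
  have lv : const_mx l + v = z - const_mx w by rewrite /v addrC subrK.
  have wl : modulus (w + l) <= B + Y.
    apply: le_trans (modulus_le_ReIm _) _; rewrite ReD ImD /= subrr normr0 add0r.
    by rewrite ler_norml; apply/andP; split; lra.
  have vB j : modulus (v ord0 j) <= 2 * B + Y.
    rewrite !mxE -addrA -opprD; apply: le_trans (modulusB _ _) _.
    have := zB j; lra.
  have hlv : height_ge m (const_mx l + v) by rewrite lv; exact: zw.
  have := chain_le df If m0 hl hlv vB YN.
  rewrite lv fl; last by rewrite /upper_half_plane.
  have -> : G w = (f (z - const_mx w) - l) + (w + l) - mean n z by rewrite /G; ring.
  have h1 := modulusB ((f (z - const_mx w) - l) + (w + l)) (mean n z).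
  have h2 := modulusD (f (z - const_mx w) - l) (w + l).
  have h3 := modulus_mean_le n_gt0 zB.
  rewrite [complex.Im l]/=; lra.
(* With [l = - w] of height [Y], the point [z - w] is [l + z], a bounded displacement from high on
   the diagonal. *)
have bottom t : modulus (G (t +i* (- Y))) <= 4864 * B ^+ 2 / Y.
  pose l : R[i] := (- t) +i* Y.
  have lE : l = - (t +i* (- Y)) by rewrite /l; apply: eq_ReIm; rewrite /= ?opprK.
  have := diagonal_second_order df If B0 n_gt0 fl dfl zB (l := l) BY.
  have -> : const_mx l + z = z - const_mx (t +i* (- Y)).
    by apply/rowP => j; rewrite !mxE lE addrC.
  have -> : f (z - const_mx (t +i* - Y)) - l - mean n z = G (t +i* - Y).
    by rewrite /G lE opprK addrA.
  by [].
have top : complex_integral (- r) r (fun t => G (t +i* 0)) =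
    complex_integral (- r) r (fun t => G (t +i* (- Y))) +
    'i * (complex_integral (- Y) 0 (fun t => G (r +i* t)) -
          complex_integral (- Y) 0 (fun t => G (- r +i* t))).
  apply/eqP; rewrite -subr_eq0 -oppr_eq0 opprB addrAC; apply/eqP.
  exact: G0.
have bound : modulus (complex_integral (- r) r (fun t => G (t +i* 0))) <=
    2 * (4864 * B ^+ 2 / Y) * (r - - r) +
    (2 * (3 ^+ N * B + 2 * B + Y) * (0 - - Y) + 2 * (3 ^+ N * B + 2 * B + Y) * (0 - - Y)).
  rewrite top; apply: le_trans (modulusD _ _) _; apply: lerD.
    by apply: complex_integral_le => //; lra.
  rewrite modulusM modulus_i mul1r; apply: le_trans (modulusB _ _) _.
  by apply: lerD; apply: complex_integral_le => //; try lra; move=> t tY; exact: side.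
(* On the real axis [G] is the translate minus the mean. *)
have tr : complex_integral (- r) r (fun t => translate t f z) =
    complex_integral (- r) r (fun t => G (t +i* 0)) + mean n z * (r - - r)%:C.
  rewrite -complex_integral_cst; last lra.
  rewrite -complex_integralD //; last exact: complex_integrable_cst.
  by apply: eq_complex_integral => t _; rewrite /G /translate addrA subrK.
have r2 : ((2 * r)^-1)%:C * (r - - r)%:C = 1 :> R[i].
  by rewrite -rmorphM; have -> : (2 * r)^-1 * (r - - r) = 1 by field; lra.
have -> : average f r z - mean n z =
    ((2 * r)^-1)%:C * complex_integral (- r) r (fun t => G (t +i* 0)).
  by rewrite /average tr mulrDr [mean n z * _]mulrC mulrA r2 mul1r addrK.
rewrite modulusM modulus_real ger0_norm; last by rewrite invr_ge0; lra.
rewrite mulrC ler_pdivrMr; last lra.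
apply: le_trans bound _; rewrite le_eqVlt; apply/orP; left; apply/eqP.
by field; rewrite !gt_eqF.
Qed.

End Averages.

(** * Choice of the parameters and locally uniform convergence *)

Theorem proposition3p1 (R : realType) (n : nat) (n_ge1 : (1 <= n)%N)
    (f : 'rV[R[i]]_n -> R[i]) (fC : class_C n f) :
  locally_uniform_cvg (upper_half_space n)
    (average f r @[r --> +oo]) (mean n).
Proof.
move=> z0 z0H.
(* Half the least height of [z0], capped by the initial value 1 of the minimum; the ball of radius
   [m] around [z0] then stays at height at least [m]. *)
pose m := (\big[Num.min/1]_j complex.Im (z0 ord0 j)) / 2.
have m0 : 0 < m by rewrite divr_gt0 //; apply: lt_bigmin => // j _; exact: z0H.
have mz0 j : 2 * m <= complex.Im (z0 ord0 j).
  by rewrite /m mulrC divfK //; exact: bigmin_le.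
pose B := m + \sum_j modulus (z0 ord0 j).
have mB : m <= B by rewrite lerDl sumr_ge0 // => j _; exact: modulus_ge0.
have z0B j : m + modulus (z0 ord0 j) <= B.
  rewrite lerD2l (bigD1 j) //= lerDl sumr_ge0 // => k _; exact: modulus_ge0.
exists (ball z0 (m%:C : R[i])); first by apply: nbhsx_ballx; rewrite ltcR.
move=> P /uniform_nbhs[E [entE EP]].
move: entE; rewrite -entourage_ballE => -[_ /ltC_real[e e0 ->] eE].
have B0 : 0 < B by lra.
have [C C0 bound] : exists2 C : R, 0 <= C & forall Y r N (z : 'rV[R[i]]_n),
    height_ge m z -> (forall j, modulus (z ord0 j) <= B) -> 64 * B <= Y ->
    48 * (2 * B + Y) < m * N%:R -> 0 < r -> modulus (average f r z - mean n z) <=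
      C * B ^+ 2 / Y + 2 * Y * (3 ^+ N * B + 2 * B + Y) / r.
  exists 9728; first exact: ler0n.
  by move=> Y r N z zm zB YB NY r0; exact: average_sub_mean_le zB YB NY r0.
(* The second summand makes the contribution [C * B ^+ 2 / Y] of the bottom side at most [e / 4]. *)
pose Y := 64 * B + C * B ^+ 2 * 4 / e.
have Q0 : 0 <= C * B ^+ 2 * 4 / e by rewrite divr_ge0 ?mulr_ge0 ?sqr_ge0 // ltW.
have Y0 : 0 < Y by rewrite /Y; lra.
have [N NY] : exists N : nat, 48 * (2 * B + Y) < m * N%:R.
  exists (Num.bound (48 * (2 * B + Y) / m)).
  rewrite [m * _]mulrC -ltr_pdivrMr //; apply: archi_boundP.
  by rewrite divr_ge0 // ltW //; lra.
pose M := 3 ^+ N * B + 2 * B + Y.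
have M0 : 0 < M.
  have : 0 <= 3 ^+ N * B by rewrite mulr_ge0 ?exprn_ge0 // ltW.
  by rewrite /M; lra.
(* Beyond this threshold the vertical sides contribute at most [e / 4]; it depends on [z0] and [e]
   but not on [z], which gives the uniformity. *)
have r1 : 0 < 8 * Y * M / e by rewrite divr_gt0 // !mulr_gt0.
apply: filterS (nbhs_pinfty_gt (num_real (8 * Y * M / e))) => r rr.
apply: EP => z [zU zH]; apply: eE => /=.
have r0 : 0 < r by exact: lt_trans rr.
have zz0 j : modulus (z ord0 j - z0 ord0 j) < m.
  have [_ zUj] := zU.
  have := zUj ord0 j; rewrite -ball_normE /= normr_modulus ltcR.
  by rewrite modulus_distC.
have zm : height_ge m z.
  move=> j; have := ge_modulus_Im (z ord0 j - z0 ord0 j).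
  rewrite ler_norml ImD ImN => /andP[h _]; have := zz0 j; have := mz0 j; lra.
have zB j : modulus (z ord0 j) <= B.
  have := modulusD (z ord0 j - z0 ord0 j) (z0 ord0 j); rewrite subrK.
  have := zz0 j; have := z0B j; lra.
rewrite -ball_normE /= normr_modulus ltcR modulus_distC.
have YB : 64 * B <= Y by rewrite lerDl.
apply: le_lt_trans (bound Y r N z zm zB YB NY r0) _.
have h1 : C * B ^+ 2 / Y <= e / 4.
  rewrite ler_pdivrMr // /Y mulrDr.
  have -> : e / 4 * (C * B ^+ 2 * 4 / e) = C * B ^+ 2 by field; lra.
  by rewrite lerDr !mulr_ge0 // ltW // divr_gt0.
have h2 : 2 * Y * M / r <= e / 4.
  rewrite ler_pdivrMr //; move: rr; rewrite ltr_pdivrMr //; lra.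
rewrite -/M; lra.
Qed.
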